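(* Let $k$ be a field, let $G$ be a group, let $\mathcal{B}$ be a $G$-graded $k$-category, let $Cl_G$ be the set of conjugacy classes of $G$ and, for $D\in Cl_G$, let $HH^D_*(\mathcal{B})=H_*(C^D_\bullet(\mathcal{B}))$. There is a decomposition $$HH_*(\mathcal{B})=\bigoplus_{D\in Cl_G}HH^D_*(\mathcal{B}).$$
   Context: A $k$-category is a small category enriched over $k$-vector spaces; the space of morphisms from $x$ to $y$ is denoted ${}_y\mathcal{B}_x$ and the set of objects $\mathcal{B}_0$. A $k$-category $\mathcal{B}$ is $G$-graded if for all $x,y\in\mathcal{B}_0$ there is a direct sum decomposition ${}_y\mathcal{B}_x=\bigoplus_{s\in G}{}_y\mathcal{B}_x^s$ such that ${}_z\mathcal{B}_y^t\,{}_y\mathcal{B}_x^s\subset{}_z\mathcal{B}_x^{ts}$ for all objects $x,y,z$ and all $s,t\in G$. The Hochschild-Mitchell homology $HH_*(\mathcal{B})$ is the homology of the chain complex $C_\bullet(\mathcal{B})$ given by $$C_n(\mathcal{B})=\bigoplus_{x_0,\dots,x_n\in\mathcal{B}_0}{}_{x_0}\mathcal{B}_{x_n}\otimes\cdots\otimes{}_{x_2}\mathcal{B}_{x_1}\otimes{}_{x_1}\mathcal{B}_{x_0},$$ with the usual Hochschild boundary $$d(f_n\otimes\cdots\otimes f_0)=\sum_{i=0}^{n-1}(-1)^i f_n\otimes\cdots\otimes f_{n-i}f_{n-i-1}\otimes\cdots\otimes f_0+(-1)^n f_0f_n\otimes f_{n-1}\otimes\cdots\otimes f_1.$$ For a conjugacy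 class $D$ of $G$, $C^D_\bullet(\mathcal{B})$ is the subcomplex of $C_\bullet(\mathcal{B})$ with $$C^D_n(\mathcal{B})=\bigoplus_{\substack{s_n\cdots s_1s_0\in D\\ x_n,\dots,x_0\in\mathcal{B}_0}}{}_{x_0}\mathcal{B}^{s_n}_{x_n}\otimes\cdots\otimes{}_{x_2}\mathcal{B}^{s_1}_{x_1}\otimes{}_{x_1}\mathcal{B}^{s_0}_{x_0}.$$ *)

(* Defs.v *)
From HB Require Import structures.
From mathcomp Require Import all_boot all_algebra finmap all_classical.

Set Implicit Arguments.
Unset Strict Implicit.
Unset Printing Implicit Defensive.

Import GRing.Theory.
Local Open Scope classical_set_scope.
Local Open Scope ring_scope.

Section Linear.
Variables (k : fieldType) (U V : lmodType k).

Definition mk_linear (f : U -> V) (flin : linear f) : {linear U -> V} :=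
  HB.pack f (GRing.isLinear.Build k U V *:%R f flin).

Lemma mk_linearE (f : U -> V) (flin : linear f) : mk_linear flin =1 f.
Proof. by []. Qed.

Lemma lin_comb_is_linear (a : k) (f g : {linear U -> V}) :
  linear (fun u => a *: f u + g u).
Proof.
move=> b u v; rewrite (linearP f) (linearP g) !scalerDr !scalerA [b * a]mulrC.
by rewrite addrACA.
Qed.

Variable W : lmodType k.

Definition mk_bilinear (f : U -> V -> W)
    (fl : forall v, linear (f^~ v)) (fr : forall u, linear (f u)) :
    {bilinear U -> V -> W} :=
  HB.pack f (bilinear_isBilinear.Build k U V W *:%R *:%R f (fl, fr)).

Lemma mk_bilinearE (f : U -> V -> W) fl fr u v : @mk_bilinear f fl fr u v = f u v.
Proof. by []. Qed.

End Linear.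

Section Submodule.
Variables (k : fieldType) (V : lmodType k).

Section Sub.
Variable S : submodClosed V.

Record submod : Type := Submod { submod_val : V; submod_valP : submod_val \in S }.

HB.instance Definition _ := [isSub for submod_val].
HB.instance Definition _ := [Choice of submod by <:].
HB.instance Definition _ := [SubChoice_isSubLmodule of submod by <:].

Lemma submod_incl_is_linear : linear submod_val.
Proof. by []. Qed.

Definition submod_incl : {linear submod -> V} := mk_linear submod_incl_is_linear.

End Sub.

Section Span.
Variable A : set V.

Definition lspan : {pred V} := fun v =>
  `[< exists s : seq (k * V),
        (forall p, p \in s -> A p.2) /\ v = \sum_(p <- s) p.1 *: p.2 >].

Lemma lspanP v : reflect (exists s : seq (k * V),
   (forall p, p \in s -> A p.2) /\ v = \sum_(p <- s) p.1 *: p.2) (v \in lspan).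
Proof. exact: asboolP. Qed.

Lemma lspan_submod_closed : submod_closed lspan.
Proof.
split.
  by apply/lspanP; exists [::]; split => //; rewrite big_nil.
move=> a u v /lspanP[s [sA ->]] /lspanP[t [tA ->]]; apply/lspanP.
exists ([seq (a * p.1, p.2) | p <- s] ++ t); split.
  move=> p; rewrite mem_cat => /orP[/mapP[q qs ->]|]; [exact: (sA q qs)|exact: tA].
rewrite big_cat big_map /= scaler_sumr; congr (_ + _).
by apply: eq_bigr => p _; rewrite scalerA.
Qed.

HB.instance Definition _ := GRing.isSubmodClosed.Build k V lspan lspan_submod_closed.

Lemma mem_lspan v : A v -> v \in lspan.
Proof.
move=> Av; apply/lspanP; exists [:: (1, v)]; split.
  by move=> p; rewrite inE => /eqP->.
by rewrite big_seq1 scale1r.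
Qed.

Lemma lspan_min (S : submodClosed V) : (forall v, A v -> v \in S) ->
  forall v, v \in lspan -> v \in S.
Proof.
move=> AS v /lspanP[s [sA ->]]; rewrite big_seq; apply: rpred_sum => p ps.
by apply: rpredZ; apply: AS; apply: sA.
Qed.

End Span.
End Submodule.

Section Quotient.
Variables (k : fieldType) (V : lmodType k) (S : submodClosed V).
Local Open Scope quotient_scope.

Definition submod_zmod : zmodClosed V := HB.pack (GRing.SubmodClosed.sort S)
  (GRing.isZmodClosed.Build V (GRing.SubmodClosed.sort S) (GRing.submod_closedB (submodClosedP S))).

Definition quotmod : Type := Quotient.quot submod_zmod.
HB.instance Definition _ := GRing.Zmodule.on quotmod.

Definition quot_pi (v : V) : quotmod := \pi_(Quotient.quot submod_zmod) v.

Lemma quot_pi_eq u v : (quot_pi u = quot_pi v) <-> (u - v \in S).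
Proof.
by rewrite -[u - v \in S]/(u - v \in submod_zmod) Quotient.idealrBE; split=> [/eqP|/eqP]. Qed.

Lemma quot_piK (q : quotmod) : quot_pi (repr (q : Quotient.quot submod_zmod)) = q.
Proof. exact: reprK. Qed.

Lemma quot_piD u v : quot_pi (u + v) = quot_pi u + quot_pi v.
Proof. exact: Quotient.pi_add. Qed.

Definition quot_scale (a : k) (q : quotmod) : quotmod :=
  quot_pi (a *: repr (q : Quotient.quot submod_zmod)).

Lemma quot_piZ a v : quot_pi (a *: v) = quot_scale a (quot_pi v).
Proof.
apply/quot_pi_eq; rewrite -scalerBr rpredZ //.
by apply/quot_pi_eq; rewrite quot_piK.
Qed.

Let scaleA a b q : quot_scale a (quot_scale b q) = quot_scale (a * b) q.
Proof. by rewrite -[q]quot_piK -!quot_piZ scalerA. Qed.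
Let scale1 : left_id 1 quot_scale.
Proof. by move=> q; rewrite -[q]quot_piK -!quot_piZ scale1r. Qed.
Let scaleDr : right_distributive quot_scale +%R.
Proof.
by move=> a q r; rewrite -[q]quot_piK -[r]quot_piK -!(quot_piZ, quot_piD) scalerDr.
Qed.
Let scaleDl q : {morph quot_scale^~ q : a b / a + b}.
Proof. by move=> a b; rewrite -[q]quot_piK -!(quot_piZ, quot_piD) scalerDl. Qed.

HB.instance Definition _ :=
  GRing.Zmodule_isLmodule.Build k quotmod scaleA scale1 scaleDr scaleDl.

Lemma quot_pi_is_linear : linear quot_pi.
Proof. by move=> a u v; rewrite quot_piD quot_piZ. Qed.

Definition quot_proj : {linear V -> quotmod} := mk_linear quot_pi_is_linear.

Lemma quot_proj_eq0 v : (quot_proj v = 0) <-> (v \in S).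
Proof. by rewrite -(linear0 quot_proj) quot_pi_eq subr0. Qed.

Lemma quot_proj_surj q : exists v, quot_proj v = q.
Proof. by exists (repr (q : Quotient.quot submod_zmod)); exact: quot_piK. Qed.

Variables (W : lmodType k) (f : {linear V -> W}).
Hypothesis f0 : forall v, v \in S -> f v = 0.

Let lift (q : quotmod) : W := f (repr (q : Quotient.quot submod_zmod)).

Let liftE v : lift (quot_pi v) = f v.
Proof.
apply/eqP; rewrite -subr_eq0 -linearB; apply/eqP/f0.
by apply/quot_pi_eq; rewrite quot_piK.
Qed.

Let lift_is_linear : linear lift.
Proof.
move=> a q r; have [u <-] := quot_proj_surj q; have [v <-] := quot_proj_surj r.
by rewrite -linearP !liftE linearP.
Qed.

Definition quot_lift : {linear quotmod -> W} := mk_linear lift_is_linear.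

Lemma quot_liftE v : quot_lift (quot_proj v) = f v.
Proof. exact: liftE. Qed.

End Quotient.

Section DirectProduct.
Variables (k : fieldType) (I : Type) (V : I -> lmodType k).

Definition dprodmod : Type := forall i, V i.
HB.instance Definition _ := Choice.on dprodmod.

Let addA : associative (fun f g : dprodmod => (fun i => f i + g i) : dprodmod).
Proof. by move=> f g h; apply/functional_extensionality_dep => i; rewrite addrA. Qed.
Let addC : commutative (fun f g : dprodmod => (fun i => f i + g i) : dprodmod).
Proof. by move=> f g; apply/functional_extensionality_dep => i; rewrite addrC. Qed.
Let add0 : left_id ((fun i => 0) : dprodmod) (fun f g : dprodmod => (fun i => f i + g i) : dprodmod).
Proof. by move=> f; apply/functional_extensionality_dep => i; rewrite add0r. Qed.
Let addN : left_inverse ((fun i => 0) : dprodmod) (fun f : dprodmod => (fun i => - f i) : dprodmod)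
  (fun f g : dprodmod => (fun i => f i + g i) : dprodmod).
Proof. by move=> f; apply/functional_extensionality_dep => i; rewrite addNr. Qed.

HB.instance Definition _ := GRing.isZmodule.Build dprodmod addA addC add0 addN.

Let scale (a : k) (f : dprodmod) : dprodmod := fun i => a *: f i.
Let scaleA a b f : scale a (scale b f) = scale (a * b) f.
Proof. by apply/functional_extensionality_dep => i; rewrite /scale scalerA. Qed.
Let scale1 : left_id 1 scale.
Proof. by move=> f; apply/functional_extensionality_dep => i; rewrite /scale scale1r. Qed.
Let scaleDr : right_distributive scale +%R.
Proof. by move=> a f g; apply/functional_extensionality_dep => i; rewrite /scale scalerDr. Qed.
Let scaleDl f : {morph scale^~ f : a b / a + b}.
Proof. by move=> a b; apply/functional_extensionality_dep => i; rewrite /scale scalerDl. Qed.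

HB.instance Definition _ :=
  GRing.Zmodule_isLmodule.Build k dprodmod scaleA scale1 scaleDr scaleDl.

End DirectProduct.

Section DirectSum.
Variables (k : fieldType) (I : Type) (V : I -> lmodType k).

Definition finite_support : {pred dprodmod V} :=
  fun f => `[< finite_set [set i | f i != 0] >].

Lemma finite_support_submod_closed : submod_closed finite_support.
Proof.
split.
  apply/asboolP; rewrite (_ : [set _ | _] = set0) //.
  by apply/seteqP; split => // i /=; rewrite eqxx.
move=> a f g /asboolP ff /asboolP gf; apply/asboolP.
apply: (@sub_finite_set _ _ ([set i | f i != 0] `|` [set i | g i != 0])); last first.
  by rewrite finite_setU.
move=> i /=; apply: contra_neqP => /not_orP[/negP + /negP].
by rewrite !negbK => /eqP fi /eqP gi; rewrite /= [LHS](_ : _ = a *: f i + g i) // fi gi scaler0 addr0.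
Qed.

HB.instance Definition _ :=
  GRing.isSubmodClosed.Build k (dprodmod V) finite_support finite_support_submod_closed.

Definition dsum : lmodType k := submod finite_support.

Definition dsum_coord (x : dsum) : forall i, V i := submod_val x.

Lemma dsum_eq (x y : dsum) : (forall i, dsum_coord x i = dsum_coord y i) -> x = y.
Proof. by move=> xy; apply/val_inj/functional_extensionality_dep. Qed.

Lemma dsum_coordP i a (x y : dsum) :
  dsum_coord (a *: x + y) i = a *: dsum_coord x i + dsum_coord y i.
Proof. by []. Qed.

Lemma dsum_support_finite (x : dsum) : finite_set [set i | dsum_coord x i != 0].
Proof. exact/asboolP/(submod_valP x). Qed.

Definition single (i : I) (v : V i) : dprodmod V := fun j =>
  match pselect (i = j) with
  | left e => eq_rect i (fun l => V l : Type) v j e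
  | right _ => 0
  end.

Arguments single i v _ : clear implicits, rename.

Lemma single_id i v : single i v i = v.
Proof.
by rewrite /single; case: pselect => // e; rewrite (Prop_irrelevance e erefl).
Qed.

Lemma single_neq i j v : i <> j -> single i v j = 0.
Proof. by rewrite /single; case: pselect. Qed.

Lemma single_finite_support i v : single i v \in finite_support.
Proof.
apply/asboolP/(@sub_finite_set _ _ [set i]); last exact: finite_set1.
move=> j /=; apply: contra_neqP => ij; rewrite single_neq // => e; exact: ij.
Qed.

Arguments single_finite_support i v : clear implicits.

Lemma dsum_in_is_linear i :
  linear (fun v => Submod (single_finite_support i v) : dsum).
Proof.
move=> a u v; apply: dsum_eq => j; rewrite dsum_coordP /dsum_coord /=.
have [e|ne] := pselect (i = j); last by rewrite !single_neq // scaler0 addr0.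
by subst j; rewrite !single_id.
Qed.

Definition dsum_in i : {linear V i -> dsum} := mk_linear (@dsum_in_is_linear i).

Lemma dsum_in_id i v : dsum_coord (dsum_in i v) i = v.
Proof. exact: single_id. Qed.

Lemma dsum_in_neq i j v : i <> j -> dsum_coord (dsum_in i v) j = 0.
Proof. exact: single_neq. Qed.

Section Lift.
Variables (W : lmodType k) (f : forall i, {linear V i -> W}).

Let lift (x : dsum) : W :=
  \sum_(i \in [set: {classic I}]) f i (dsum_coord x i).

Let liftE (A : set {classic I}) (x : dsum) : finite_set A ->
  (forall i, ~ A i -> dsum_coord x i = 0) ->
  lift x = \sum_(i <- fset_set A) f i (dsum_coord x i).
Proof.
move=> Afin xA; rewrite /lift -fsbig_finite //.
by apply/esym/fsbig_widen => // i /= [_ /xA ->]; rewrite linear0.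
Qed.

Let lift_is_linear : linear lift.
Proof.
move=> a x y.
pose A : set {classic I} :=
  [set i | dsum_coord x i != 0] `|` [set i | dsum_coord y i != 0].
have Af : finite_set A.
  by rewrite /A finite_setU; split; exact: dsum_support_finite.
have xA i : ~ A i -> dsum_coord x i = 0.
  by move=> /not_orP[/negP + _]; rewrite negbK => /eqP.
have yA i : ~ A i -> dsum_coord y i = 0.
  by move=> /not_orP[_ /negP]; rewrite negbK => /eqP.
have xyA i : ~ A i -> dsum_coord (a *: x + y) i = 0.
  by move=> Ai; rewrite dsum_coordP xA // yA // scaler0 addr0.
rewrite (liftE Af xA) (liftE Af yA) (liftE Af xyA).
rewrite scaler_sumr -big_split /=; apply: eq_bigr => i _.
exact: (linearP (f i) a (dsum_coord x i) (dsum_coord y i)).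
Qed.

(** The linear map out of the direct sum whose restriction to the summand [V i]
    is [f i]. *)
Definition dsum_lift : {linear dsum -> W} := mk_linear lift_is_linear.

Lemma dsum_lift_in i v : dsum_lift (dsum_in i v) = f i v.
Proof.
rewrite /dsum_lift mk_linearE (@liftE [set i]) //.
- by rewrite fset_set1 big_seq_fset1 dsum_in_id.
- by move=> j ij; rewrite dsum_in_neq // => e; exact: ij.
Qed.

End Lift.

Lemma dsum_sum (x : dsum) :
  x = \sum_(i <- fset_set ([set i | dsum_coord x i != 0] : set {classic I}))
        dsum_in i (dsum_coord x i).
Proof.
set A : set {classic I} := [set i | _].
have Af : finite_set A by exact: dsum_support_finite.
have coord_sum (r : seq {classic I}) (F : {classic I} -> dsum) j :
    dsum_coord (\sum_(i <- r) F i) j = \sum_(i <- r) dsum_coord (F i) j.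
  by elim: r => [|i r ih]; rewrite ?(big_nil, big_cons) // -ih.
apply: dsum_eq => j; rewrite coord_sum.
have [jA|jA] := boolP ((j : {classic I}) \in fset_set A); last first.
  rewrite big_seq big1 => [|i iA].
    move: jA; rewrite in_fset_set // notin_setE /A /= => /negP.
    by rewrite negbK => /eqP.
  by rewrite dsum_in_neq // => e; move: jA; rewrite -e iA.
rewrite (big_fsetD1 _ jA) dsum_in_id big_seq big1 ?Monoid.mulm1 // => i.
by rewrite !inE => /andP[/eqP ij _]; rewrite dsum_in_neq.
Qed.

Lemma dsum_ext (W : lmodType k) (f g : {linear dsum -> W}) :
  (forall i v, f (dsum_in i v) = g (dsum_in i v)) -> f =1 g.
Proof.
move=> fg x; rewrite [x]dsum_sum !linear_sum; apply: eq_bigr => i _.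
exact: fg.
Qed.

End DirectSum.

Section Tensor.
Variables (k : fieldType) (U V : lmodType k).

Definition free_mod (T : Type) : lmodType k := dsum (fun _ : T => k^o).
Definition free_gen (T : Type) (t : T) : free_mod T := dsum_in (fun _ : T => k^o) t 1.

Definition tensor_relations : set (free_mod (U * V)) := [set r |
  (exists a u u' v,
     r = free_gen (a *: u + u', v) - (a *: free_gen (u, v) + free_gen (u', v))) \/
  (exists a u v v',
     r = free_gen (u, a *: v + v') - (a *: free_gen (u, v) + free_gen (u, v')))].

Definition tensor : lmodType k := quotmod (lspan tensor_relations).

Definition tpure (u : U) (v : V) : tensor :=
  quot_proj (lspan tensor_relations) (free_gen (u, v)).

Lemma tpure_linearl v : linear (tpure^~ v).
Proof.
move=> a u u'; rewrite /tpure -linearP; apply/quot_pi_eq/mem_lspan.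
by left; exists a, u, u', v.
Qed.

Lemma tpure_linearr u : linear (tpure u).
Proof.
move=> a v v'; rewrite /tpure -linearP; apply/quot_pi_eq/mem_lspan.
by right; exists a, u, v, v'.
Qed.

Lemma tensor_ext (W : lmodType k) (f g : {linear tensor -> W}) :
  (forall u v, f (tpure u v) = g (tpure u v)) -> f =1 g.
Proof.
move=> fg t; have [x <-] := quot_proj_surj t.
have e : (f \o quot_proj (lspan tensor_relations) : {linear _ -> _}) =1
   (g \o quot_proj (lspan tensor_relations) : {linear _ -> _}).
  apply: dsum_ext => -[u v] a.
  have -> : dsum_in (fun _ : U * V => k^o) (u, v) a = a *: free_gen (u, v).
    by rewrite /free_gen -linearZ /= [a *: _]mulr1.
  by rewrite !linearZ; congr (_ *: _); exact: fg.
exact: e.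
Qed.

Variables (W : lmodType k) (f : {bilinear U -> V -> W}).

Let scale_gen (w : W) : linear (fun a : k^o => a *: w).
Proof. by move=> a b c /=; rewrite scalerDl scalerA. Qed.

Let free_lift : {linear free_mod (U * V) -> W} :=
  dsum_lift (fun p => mk_linear (scale_gen (f p.1 p.2))).

Let free_lift_gen p : free_lift (free_gen p) = f p.1 p.2.
Proof. by rewrite /free_lift dsum_lift_in /= scale1r. Qed.

Let free_lift0 r : r \in lspan tensor_relations -> free_lift r = 0.
Proof.
move=> /lspanP[s [sA ->]]; rewrite linear_sum big_seq big1 // => p /sA rp.
suff e : free_lift p.2 = 0 by rewrite [LHS](linearZZ free_lift) e scaler0.
case: rp => -[a [x [y [z ->]]]]; rewrite linearB linearP !free_lift_gen.
  by rewrite linearPl subrr.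
by rewrite linearPr subrr.
Qed.

Definition tensor_lift : {linear tensor -> W} := quot_lift free_lift0.

Lemma tensor_liftE u v : tensor_lift (tpure u v) = f u v.
Proof. by rewrite /tensor_lift quot_liftE free_lift_gen. Qed.

End Tensor.

Section TensorMap.
Variables (k : fieldType) (U U' V V' : lmodType k).
Variables (f : {linear U -> U'}) (g : {linear V -> V'}).

Let tens_fg (u : U) (v : V) : tensor U' V' := tpure (f u) (g v).

Let tens_fg_linearl v : linear (tens_fg^~ v).
Proof. by move=> a u u'; rewrite /tens_fg linearP tpure_linearl. Qed.
Let tens_fg_linearr u : linear (tens_fg u).
Proof. by move=> a v v'; rewrite /tens_fg linearP tpure_linearr. Qed.

Definition tensor_map : {linear tensor U V -> tensor U' V'} :=
  tensor_lift (mk_bilinear tens_fg_linearl tens_fg_linearr).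

Lemma tensor_map_pure u v : tensor_map (tpure u v) = tpure (f u) (g v).
Proof. exact: tensor_liftE. Qed.

End TensorMap.

Lemma alternating_sum_eq0 (k : fieldType) (V : lmodType k) m (F : nat -> nat -> V) :
  (forall i j, (i < j <= m)%N -> F i j = F j.-1 i) ->
  \sum_(j < m.+1) \sum_(i < m) (-1) ^+ (i + j) *: F i j = 0.
Proof.
move=> FF; pose t i j := (-1) ^+ (i + j) *: F i j.
have -> : \sum_(j < m.+1) \sum_(i < m) t i j =
    \sum_(j < m.+1) \sum_(i < m | (i < j)%N) t i j +
    \sum_(j < m.+1) \sum_(i < m | (j <= i)%N) t i j.
  rewrite -big_split; apply: eq_bigr => j _; rewrite (bigID (fun i : 'I_m => (i < j)%N)).
  by congr (_ + _); apply: eq_bigl => i; rewrite -leqNgt.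
rewrite big_ord_recl big1 => [|i //]; rewrite add0r.
rewrite [X in _ + X]big_ord_recr /= [X in _ + (_ + X)]big1 => [|i]; last first.
  by rewrite leqNgt ltn_ord.
rewrite addr0 (exchange_big_dep xpredT) //= -big_split big1 // => i _ /=.
rewrite -big_split big1 // => j ij.
rewrite /t /bump add1n FF; last by rewrite ltnS; case/andP: (conj ij (ltn_ord j)).
rewrite addnS exprS mulN1r scaleNr [(j + i)%N]addnC; exact: addNr.
Qed.

Section Complex.
Variable k : fieldType.

Record chain_complex := ChainComplex {
  cc_mod :> nat -> lmodType k;
  cc_d : forall n, {linear cc_mod n.+1 -> cc_mod n};
  cc_dd : forall n x, cc_d n (cc_d n.+1 x) = 0 }.

Section Homology.
Variable C : chain_complex.

(** The differential out of degree [0] is zero. *)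
Definition is_cycle (n : nat) : {pred C n} :=
  match n with
  | 0 => fun=> true
  | m.+1 => fun x => cc_d C m x == 0
  end.

Lemma is_cycle_submod_closed n : submod_closed (@is_cycle n).
Proof.
case: n => [|n]; split => //; rewrite /is_cycle /in_mem /= ?linear0 //.
move=> a x y /eqP x0 /eqP y0; apply/eqP.
by rewrite (linearP (cc_d C n)) x0 y0 scaler0 addr0.
Qed.

HB.instance Definition _ n :=
  GRing.isSubmodClosed.Build k (C n) (@is_cycle n) (is_cycle_submod_closed n).

Definition cycles n : lmodType k := submod (@is_cycle n).

Definition is_boundary n : {pred cycles n} :=
  fun z => `[< exists y : C n.+1, cc_d C n y = submod_val z >].

Lemma is_boundary_submod_closed n : submod_closed (@is_boundary n).
Proof.
split; first by apply/asboolP; exists 0; rewrite linear0.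
move=> a u v /asboolP[x xu] /asboolP[y yv]; apply/asboolP; exists (a *: x + y).
by rewrite linearP xu yv.
Qed.

HB.instance Definition _ n :=
  GRing.isSubmodClosed.Build k (cycles n) (@is_boundary n) (is_boundary_submod_closed n).

Definition homology n : lmodType k := quotmod (@is_boundary n).

Definition homology_class n : {linear cycles n -> homology n} :=
  quot_proj (@is_boundary n).

End Homology.

Record chain_map (C C' : chain_complex) := ChainMap {
  cm_map :> forall n, {linear C n -> C' n};
  cm_d : forall n x, cc_d C' n (cm_map n.+1 x) = cm_map n (cc_d C n x) }.

Section HomologyMap.
Variables (C C' : chain_complex) (f : chain_map C C').

Lemma cycles_map_subproof n (z : cycles C n) : f n (submod_val z) \in @is_cycle C' n.
Proof.
case: n z => [|n] [x] //=; rewrite /is_cycle /in_mem /= => /eqP x0.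
by rewrite cm_d [cc_d C n x]x0 linear0.
Qed.

Lemma cycles_map_is_linear n :
  linear (fun z : cycles C n => Submod (cycles_map_subproof z) : cycles C' n).
Proof. by move=> a u v; apply: val_inj; rewrite /= linearP. Qed.

Definition cycles_map n : {linear cycles C n -> cycles C' n} :=
  mk_linear (@cycles_map_is_linear n).

Lemma homology_map_subproof n (z : cycles C n) : z \in @is_boundary C n ->
  homology_class C' n (cycles_map n z) = 0.
Proof.
move=> /asboolP[y yz]; apply/quot_proj_eq0/asboolP; exists (f n.+1 y).
by rewrite cm_d yz.
Qed.

Definition homology_map n : {linear homology C n -> homology C' n} :=
  @quot_lift _ _ _ _ (homology_class C' n \o cycles_map n)
    (@homology_map_subproof n).

Lemma homology_map_class n (z : cycles C n) :
  homology_map n (homology_class C n z) = homology_class C' n (cycles_map n z).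
Proof. exact: quot_liftE. Qed.

End HomologyMap.

Record subcomplex (C : chain_complex) := Subcomplex {
  sc_sub :> forall n, submodClosed (C n);
  sc_d : forall n x, x \in sc_sub n.+1 -> cc_d C n x \in sc_sub n }.

Section SubComplex.
Variables (C : chain_complex) (S : subcomplex C).

Lemma sub_d_is_linear n : linear (fun x : submod (S n.+1) =>
  Submod (sc_d (submod_valP x)) : submod (S n)).
Proof. by move=> a u v; apply: val_inj; rewrite /= linearP. Qed.

Definition sub_d n : {linear submod (S n.+1) -> submod (S n)} :=
  mk_linear (@sub_d_is_linear n).

Lemma sub_dd n x : sub_d n (sub_d n.+1 x) = 0.
Proof. by apply: val_inj; rewrite /= cc_dd. Qed.

Definition sub_complex : chain_complex := ChainComplex sub_dd.

Definition sub_complex_incl : chain_map sub_complex C :=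
  @ChainMap sub_complex C (fun n => submod_incl (S n)) (fun n x => erefl).

End SubComplex.
End Complex.

(** [hom x y] is the space of morphisms from [x] to [y], written {}_yB_x, and
    [comp g f] is the composite of [f] followed by [g]. *)
Record kCategory (k : fieldType) := KCategory {
  kobj :> Type;
  hom : kobj -> kobj -> lmodType k;
  comp : forall x y z, {bilinear hom y z -> hom x y -> hom x z};
  idm : forall x, hom x x;
  comp_idl : forall x y (f : hom x y), comp x y y (idm y) f = f;
  comp_idr : forall x y (f : hom x y), comp x x y f (idm x) = f;
  compA : forall x y z w (h : hom z w) (g : hom y z) (f : hom x y),
    comp x z w h (comp x y z g f) = comp x y w (comp y z w h g) f }.

Arguments comp {k B x y z} : rename.
Arguments hom {k B} : rename.

Record grading (G : groupType) (k : fieldType) (B : kCategory k) := Grading {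
  piece : forall x y : B, G -> submodClosed (hom x y);
  piece_dsum : forall x y,
    bijective (dsum_lift (fun s : G => submod_incl (piece x y s)));
  piece_comp : forall x y z (s t : G) (f : hom x y) (g : hom y z),
    f \in piece x y s -> g \in piece y z t -> comp g f \in piece x z (t * s)%g }.

Section HochschildMitchell.
Variables (k : fieldType) (B : kCategory k).

Fixpoint objs (n : nat) : Type := if n is m.+1 then (B * objs m)%type else unit.

(** For [s = (x_1, ..., x_n)], [tens n x s y] is the space
    {}_yB_{x_n} ⊗ ... ⊗ {}_{x_2}B_{x_1} ⊗ {}_{x_1}B_x. *)
Fixpoint tens (n : nat) (x : B) : objs n -> B -> lmodType k :=
  match n with
  | 0 => fun _ y => hom x y
  | m.+1 => fun s y => tensor (tens s.1 s.2 y) (hom x s.1)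
  end.

(** Sequences of morphisms [(f_n, ..., f_0)] along x -> x_1 -> ... -> x_n -> y. *)
Fixpoint morphs (n : nat) (x : B) : objs n -> B -> Type :=
  match n with
  | 0 => fun _ y => hom x y
  | m.+1 => fun s y => (morphs s.1 s.2 y * hom x s.1)%type
  end.

Fixpoint elem_tens (n : nat) : forall x (s : objs n) y, morphs x s y -> tens x s y :=
  match n with
  | 0 => fun _ _ _ c => c
  | m.+1 => fun _ _ _ c => tpure (elem_tens c.1) c.2
  end.

Lemma tens_ext (W : lmodType k) n x (s : objs n) y (f g : {linear tens x s y -> W}) :
  (forall c, f (elem_tens c) = g (elem_tens c)) -> f =1 g.
Proof.
elim: n x s W f g => [|n ih] x s W f g fg; first exact: fg.
apply: tensor_ext => t v.
have fv : linear (fun t => f (tpure t v)).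
  by move=> a t1 t2; rewrite tpure_linearl linearP.
have gv : linear (fun t => g (tpure t v)).
  by move=> a t1 t2; rewrite tpure_linearl linearP.
exact: (ih _ _ _ (mk_linear fv) (mk_linear gv) (fun c => fg (c, v))).
Qed.

(** [postcomp h] replaces [f_n] by the composite of [h] and [f_n]. *)
Fixpoint postcomp (n : nat) : forall x (s : objs n) y y', hom y y' ->
    {linear tens x s y -> tens x s y'} :=
  match n with
  | 0 => fun x _ y y' h => mk_linear (linearPr (@comp k B x y y') h)
  | m.+1 => fun x s y y' h => tensor_map (postcomp s.1 s.2 h) idfun
  end.

(** [precomp f] replaces [f_0] by the composite of [f_0] and [f]. *)
Definition precomp (n : nat) : forall x z (s : objs n) y, hom x z ->
    {linear tens z s y -> tens x s y} :=
  match n with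
  | 0 => fun x z _ y f => mk_linear (linearPl (@comp k B x z y) f)
  | m.+1 => fun x z s y f =>
      tensor_map idfun (mk_linear (linearPl (@comp k B x z s.1) f))
  end.

Fixpoint morphs_post (n : nat) : forall x (s : objs n) y y', hom y y' ->
    morphs x s y -> morphs x s y' :=
  match n with
  | 0 => fun _ _ _ _ h c => comp h c
  | m.+1 => fun _ _ _ _ h c => (morphs_post h c.1, c.2)
  end.

Definition morphs_pre (n : nat) : forall x z (s : objs n) y, hom x z ->
    morphs z s y -> morphs x s y :=
  match n with
  | 0 => fun _ _ _ _ f c => comp c f
  | m.+1 => fun _ _ _ _ f c => (c.1, comp c.2 f)
  end.

Lemma postcomp_elem n x (s : objs n) y y' (h : hom y y') c :
  postcomp x s h (elem_tens c) = elem_tens (morphs_post h c).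
Proof.
elim: n x s c => [//|n ih] x s c.
by rewrite [LHS]tensor_map_pure ih.
Qed.

Lemma precomp_elem n x z (s : objs n) y (f : hom x z) (c : morphs z s y) :
  precomp s y f (elem_tens c) = elem_tens (morphs_pre f c).
Proof. by case: n s c => [//|n] s c; rewrite [LHS]tensor_map_pure. Qed.

Lemma postcomp_linear n x (s : objs n) y y' t :
  linear (fun h : hom y y' => postcomp x s h t).
Proof.
move=> a h h'.
have L := lin_comb_is_linear a (postcomp x s h) (postcomp x s h').
apply: (tens_ext (g := mk_linear L)) => c /=; rewrite !postcomp_elem.
elim: n x s c {t L} => [|n ih] x s c /=; first by rewrite linearPl.
by rewrite ih tpure_linearl.
Qed.

Lemma precomp_linear n x z (s : objs n) y t :
  linear (fun f : hom x z => precomp s y f t).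
Proof.
move=> a h h'.
have L := lin_comb_is_linear a (precomp s y h) (precomp s y h').
apply: (tens_ext (g := mk_linear L)) => c /=; rewrite !precomp_elem.
by case: n s t c {L} => [|n] s t c /=; rewrite linearPr ?tpure_linearr.
Qed.

(** t ⊗ f_0 |-> [precomp f_0 t] *)
Definition compose_first n x z (s : objs n) y :
    {linear tensor (tens z s y) (hom x z) -> tens x s y} :=
  tensor_lift (@mk_bilinear _ _ _ _ (fun t f => precomp s y f t)
    (fun f => linearP (precomp s y f)) (@precomp_linear n x z s y)).

(** t ⊗ f_0 |-> [postcomp f_0 t] *)
Definition compose_last n x z (s : objs n) :
    {linear tensor (tens z s x) (hom x z) -> tens z s z} :=
  tensor_lift (@mk_bilinear _ _ _ _ (fun t f => postcomp z s f t)
    (fun f => linearP (postcomp z s f)) (@postcomp_linear n z s x z)).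

(** [del j s] removes from [s] its component number [j], counting from [0]; when
    [j] is too large, it removes the last component. *)
Fixpoint del (n j : nat) : objs n.+1 -> objs n :=
  match n, j with
  | 0, _ => fun=> tt
  | m.+1, 0 => fun s => s.2
  | m.+1, i.+1 => fun s => (s.1, del i s.2)
  end.

(** The [j]-th inner face, which composes [f_(j+1)] and [f_j]. *)
Fixpoint face (n j : nat) : forall x (s : objs n.+1) y,
    {linear tens x s y -> tens x (del j s) y} :=
  match n, j with
  | 0, _ => fun x s y => @compose_first 0 x s.1 tt y
  | m.+1, 0 => fun x s y => @compose_first m.+1 x s.1 s.2 y
  | m.+1, i.+1 => fun x s y => tensor_map (face i s.1 s.2 y) idfun
  end.

Fixpoint morphs_face (n j : nat) : forall x (s : objs n.+1) y,
    morphs x s y -> morphs x (del j s) y :=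
  match n, j with
  | 0, _ => fun x (s : objs 1) y (c : morphs x s y) =>
      comp (c.1 : hom s.1 y) c.2
  | m.+1, 0 => fun x s y c => @morphs_pre m.+1 x s.1 s.2 y c.2 c.1
  | m.+1, i.+1 => fun x s y c => (@morphs_face m i s.1 s.2 y c.1, c.2)
  end.

Lemma face_elem n j x (s : objs n.+1) y c :
  face j x s y (elem_tens c) = elem_tens (morphs_face j c).
Proof.
elim: n j x s c => [|n ih] [|j] x s c.
- exact: tensor_liftE.
- exact: tensor_liftE.
- by rewrite [LHS]tensor_liftE [LHS]precomp_elem.
- by rewrite [LHS]tensor_map_pure ih.
Qed.

Lemma compose_last_elem n x z (s : objs n) (c : morphs z s x) (f : hom x z) :
  compose_last x z s (tpure (elem_tens c) f) = elem_tens (morphs_post f c).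
Proof. by rewrite tensor_liftE -postcomp_elem. Qed.

(** [p : objs n.+1] stands for [(x_0, ..., x_n)]. *)
Definition HM_mod (n : nat) : lmodType k :=
  dsum (fun p : objs n.+1 => tens p.1 p.2 p.1).

Definition HM_in n (p : objs n.+1) : {linear tens p.1 p.2 p.1 -> HM_mod n} :=
  dsum_in (fun p : objs n.+1 => tens p.1 p.2 p.1) p.

(** f_n ⊗ ... ⊗ f_0 |-> f_n ⊗ ... ⊗ f_(j+1) f_j ⊗ ... ⊗ f_0 *)
Definition HM_face n (j : nat) : {linear HM_mod n.+1 -> HM_mod n} :=
  dsum_lift (fun p : objs n.+2 =>
    @HM_in n (p.1, del j p.2) \o face j p.1 p.2 p.1).

(** f_n ⊗ ... ⊗ f_0 |-> f_0 f_n ⊗ f_(n-1) ⊗ ... ⊗ f_1 *)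
Definition HM_last n : {linear HM_mod n.+1 -> HM_mod n} :=
  dsum_lift (fun p : objs n.+2 => @HM_in n p.2 \o compose_last p.1 p.2.1 p.2.2).

(** The [i]-th inner term composes f_(n+1-i) and f_(n-i). *)
Definition HM_d_fun n (v : HM_mod n.+1) : HM_mod n :=
  \sum_(i < n.+1) (-1) ^+ i *: HM_face n (n - i) v + (-1) ^+ n.+1 *: HM_last n v.

Lemma HM_d_is_linear n : linear (@HM_d_fun n).
Proof.
move=> a u v; rewrite /HM_d_fun (linearP (HM_last n)).
have -> : \sum_(i < n.+1) (-1) ^+ i *: HM_face n (n - i) (a *: u + v) =
    a *: (\sum_(i < n.+1) (-1) ^+ i *: HM_face n (n - i) u) +
    \sum_(i < n.+1) (-1) ^+ i *: HM_face n (n - i) v.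
  rewrite scaler_sumr -big_split; apply: eq_bigr => i _.
  by rewrite (linearP (HM_face n (n - i))) scalerDr !scalerA [a * _]mulrC.
by rewrite !scalerDr !scalerA [a * _]mulrC addrACA.
Qed.

Definition HM_d n : {linear HM_mod n.+1 -> HM_mod n} := mk_linear (@HM_d_is_linear n).

(** A sequence (f_n, ..., f_0) along a cycle x_0 -> x_1 -> ... -> x_n -> x_0. *)
Definition cyc n : Type := {p : objs n.+1 & morphs p.1 p.2 p.1}.

Definition elem n (c : cyc n) : HM_mod n := HM_in (projT1 c) (elem_tens (projT2 c)).

Definition cyc_face n j (c : cyc n.+1) : cyc n :=
  let p := projT1 c in
  existT (fun q : objs n.+1 => morphs q.1 q.2 q.1) (p.1, del j p.2)
    (@morphs_face n j p.1 p.2 p.1 (projT2 c)).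

Definition cyc_last n (c : cyc n.+1) : cyc n :=
  let p : objs n.+2 := projT1 c in
  existT (fun q : objs n.+1 => morphs q.1 q.2 q.1) p.2
    (@morphs_post n p.2.1 p.2.2 p.1 p.2.1 (projT2 c).2 (projT2 c).1).

Lemma HM_face_elem n j (c : cyc n.+1) : HM_face n j (elem c) = elem (cyc_face j c).
Proof.
case: c => p c; rewrite /elem /HM_face dsum_lift_in.
by rewrite [LHS]/= face_elem.
Qed.

Lemma HM_last_elem n (c : cyc n.+1) : HM_last n (elem c) = elem (cyc_last c).
Proof.
case: c => p c; rewrite /elem /HM_last dsum_lift_in.
exact: (congr1 (HM_in (n := n) p.2) (@compose_last_elem n p.1 p.2.1 p.2.2 c.1 c.2)).
Qed.

Lemma HM_d_elem n (c : cyc n.+1) :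
  HM_d n (elem c) = \sum_(i < n.+1) (-1) ^+ i *: elem (cyc_face (n - i) c) +
                    (-1) ^+ n.+1 *: elem (cyc_last c).
Proof.
rewrite /HM_d mk_linearE /HM_d_fun HM_last_elem; congr (_ + _).
by apply: eq_bigr => i _; rewrite HM_face_elem.
Qed.

Lemma HM_ext (W : lmodType k) n (f g : {linear HM_mod n -> W}) :
  (forall c, f (elem c) = g (elem c)) -> f =1 g.
Proof.
move=> fg; apply: dsum_ext => p.
exact: (@tens_ext W n p.1 p.2 p.1 (f \o HM_in (n := n) p) (g \o HM_in (n := n) p)
  (fun c => fg (existT _ p c))).
Qed.

Lemma morphs_pre_pre n x z w (s : objs n) y (c : morphs w s y) (g : hom z w) (f : hom x z) :
  morphs_pre f (morphs_pre g c) = morphs_pre (comp g f) c.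
Proof. by case: n s c => [|n] s c /=; rewrite compA. Qed.

Lemma morphs_post_post n x (s : objs n) y z w (c : morphs x s y) (h : hom y z) (h' : hom z w) :
  morphs_post h' (morphs_post h c) = morphs_post (comp h' h) c.
Proof. by elim: n x s c => [|n ih] x s c /=; rewrite ?compA ?ih. Qed.

Lemma morphs_face_post n j x (s : objs n.+1) y z (c : morphs x s y) (h : hom y z) :
  morphs_face j (morphs_post h c) = morphs_post h (morphs_face j c).
Proof.
elim: n j x s c => [|n ih] [|j] x s c //=; try by rewrite compA.
by rewrite -ih.
Qed.

(* The two sides live over [del a (del b s)] and [del b (del a.+1 s)], which are
   equal but not convertible; [P] makes the statement typecheck. *)
Lemma morphs_face_face T n a b x (s : objs n.+2) y (c : morphs x s y)
    (P : forall s : objs n, morphs x s y -> T) : (b <= a)%N ->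
  P _ (morphs_face a (morphs_face b c)) = P _ (morphs_face b (morphs_face a.+1 c)).
Proof.
elim: n a b x s c P => [|n ih] [|a] [|b] x s c P //= ba;
  rewrite ?compA ?morphs_pre_pre //.
exact: (ih a b s.1 s.2 c.1 (fun s' c' => P (s.1, s') (c', c.2))).
Qed.

Lemma cyc_face_face n a b (c : cyc n.+2) : (b <= a)%N ->
  cyc_face a (cyc_face b c) = cyc_face b (cyc_face a.+1 c).
Proof.
case: c => [[x s] c] ba.
exact: (@morphs_face_face (cyc n) n a b x s x c
  (fun s' c' => existT (fun q : objs n.+1 => morphs q.1 q.2 q.1) (x, s') c')).
Qed.

Lemma cyc_face_last n a (c : cyc n.+2) :
  cyc_face a (cyc_last c) = cyc_last (cyc_face a.+1 c).
Proof.
case: c => [[x [z s]] [c f]]; rewrite /cyc_face /cyc_last /=.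
by rewrite morphs_face_post.
Qed.

Lemma cyc_last_last n (c : cyc n.+2) :
  cyc_last (cyc_last c) = cyc_last (cyc_face 0 c).
Proof.
case: c => [[x [z [w s]]] [[c g] f]]; rewrite /cyc_face /cyc_last /=.
by rewrite morphs_post_post.
Qed.

Let cyc_d n i (c : cyc n.+1) : cyc n :=
  if (i <= n)%N then cyc_face (n - i) c else cyc_last c.

Let cyc_dd n i j (c : cyc n.+2) : (i < j <= n.+2)%N ->
  cyc_d i (cyc_d j c) = cyc_d j.-1 (cyc_d i c).
Proof.
case: j => [|j] /andP[//= ij jn].
have {}ij : (i <= j)%N by [].
have [jn1|jn1] := leqP j n.
  have i_n := leq_trans ij jn1.
  rewrite /cyc_d ltnS jn1 i_n (leqW i_n) subSS cyc_face_face ?subSn //.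
  exact: leq_sub2l.
have {jn1} ej : j = n.+1 by apply/eqP; rewrite eqn_leq jn1 andbT.
subst j; rewrite /cyc_d !ltnn ij.
have [i_n|i_n] := leqP i n; first by rewrite cyc_face_last subSn.
have -> : i = n.+1 by apply/eqP; rewrite eqn_leq i_n ij.
by rewrite subnn cyc_last_last.
Qed.

Let HM_d_elemE n (c : cyc n.+1) :
  HM_d n (elem c) = \sum_(i < n.+2) (-1) ^+ i *: elem (cyc_d i c).
Proof.
rewrite HM_d_elem [RHS]big_ord_recr /= {2}/cyc_d ltnn; congr (_ + _).
by apply: eq_bigr => i _; rewrite /cyc_d -ltnS ltn_ord.
Qed.

Lemma HM_dd n v : HM_d n (HM_d n.+1 v) = 0.
Proof.
have zlin : linear (fun _ : HM_mod n.+2 => 0 : HM_mod n).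
  by move=> a u w; rewrite scaler0 addr0.
apply: (HM_ext (f := HM_d n \o HM_d n.+1) (g := mk_linear zlin)) => c.
transitivity (HM_d n (HM_d n.+1 (elem c))) => //.
rewrite (HM_d_elemE c) linear_sum [RHS]mk_linearE.
rewrite -[RHS](@alternating_sum_eq0 k (HM_mod n) n.+2
  (fun i j => elem (cyc_d i (cyc_d j c)))).
  apply: eq_bigr => j _.
  rewrite linearZZ HM_d_elemE scaler_sumr; apply: eq_bigr => i _.
  by rewrite scalerA -exprD addnC.
by move=> i j ij; rewrite cyc_dd.
Qed.

Definition HM_complex : chain_complex k := ChainComplex HM_dd.

Definition HH (n : nat) : lmodType k := homology HM_complex n.

End HochschildMitchell.

Record conj_class (G : groupType) := ConjClass {
  conj_set : set G;
  conj_setP : exists g : G, conj_set = [set conjg g h | h in [set: G]] }.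

Lemma conj_class_mulC (G : groupType) (D : conj_class G) (s t : G) :
  conj_set D (s * t)%g -> conj_set D (t * s)%g.
Proof.
case: D => D /= [g ->] [h _ gh]; exists (h * s)%g => //.
by rewrite conjgM gh conjgE mulgA mulKg.
Qed.

Section GradedHochschildMitchell.
Variables (k : fieldType) (G : groupType) (B : kCategory k) (gr : grading G B).

(** Each [f_i] is homogeneous of some degree [s_i], and [s_n ... s_1 s_0 = g]. *)
Fixpoint has_degree (n : nat) : forall x (s : objs B n) y, morphs x s y -> G -> Prop :=
  match n with
  | 0 => fun x _ y c g => c \in piece gr x y g
  | m.+1 => fun x s y c g => exists t u : G,
      [/\ has_degree c.1 t, c.2 \in piece gr x s.1 u & g = (t * u)%g]
  end.

(** Over a field, the tensor product of the homogeneous pieces embeds in the tensor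
    product of the morphism spaces; [HMD_sub] is the span of the image, that is,
    of the f_n ⊗ ... ⊗ f_0 with f_i of degree s_i and s_n ... s_1 s_0 in D. *)
Definition HMD_gen (D : conj_class G) n : set (HM_mod B n) := [set v |
  exists (c : cyc B n) (g : G), [/\ has_degree (projT2 c) g, conj_set D g & v = elem c]].

Lemma has_degree_post n x (s : objs B n) y z c (h : hom y z) t u :
  has_degree c t -> h \in piece gr y z u -> has_degree (@morphs_post _ B n x s y z h c) (u * t)%g.
Proof.
elim: n x s c t => [|n ih] x s c t /= ct hu; first exact: piece_comp ct hu.
case: ct => t1 [t2 [c1 c2 ->]]; exists (u * t1)%g, t2; split => //; last by rewrite mulgA.
exact: ih.
Qed.

Lemma has_degree_pre n x z (s : objs B n) y c (f : hom x z) t u :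
  has_degree c t -> f \in piece gr x z u -> has_degree (@morphs_pre _ B n x z s y f c) (t * u)%g.
Proof.
case: n s c => [|n] s c /= ct fu; first exact: piece_comp fu ct.
case: ct => t1 [t2 [c1 c2 ->]]; exists t1, (t2 * u)%g; split => //; last by rewrite mulgA.
exact: piece_comp fu c2.
Qed.

Lemma has_degree_face n j x (s : objs B n.+1) y c g :
  has_degree c g -> has_degree (@morphs_face _ B n j x s y c) g.
Proof.
elim: n j x s c g => [|n ih] j x s c g.
  by case: j => [|j] [t [u [c1 c2 ->]]]; exact: piece_comp c2 c1.
case: j => [|j] [t [u [c1 c2 ->]]].
  exact: (@has_degree_pre n.+1 x s.1 s.2 y c.1 c.2 t u c1 c2).
by exists t, u; split => //; exact: ih.
Qed.

Lemma HM_face_HMD D n j v : HMD_gen D v -> HMD_gen D (HM_face B n j v).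
Proof.
move=> [c [g [cg Dg ->]]]; rewrite HM_face_elem; exists (cyc_face j c), g.
by split => //; exact: has_degree_face.
Qed.

Lemma HM_last_HMD D n v : HMD_gen D v -> HMD_gen D (HM_last B n v).
Proof.
move=> [c [g [[t [u [c1 c2 ->]]] Dg ->]]]; rewrite HM_last_elem.
exists (cyc_last c), (u * t)%g; split => //; last exact: conj_class_mulC.
exact: has_degree_post c1 c2.
Qed.

Definition HMD_sub (D : conj_class G) n : submodClosed (HM_mod B n) := lspan (@HMD_gen D n).

Lemma HMD_sub_d D n v : v \in HMD_sub D n.+1 -> HM_d B n v \in HMD_sub D n.
Proof.
move=> /lspanP[r [rD ->]]; rewrite linear_sum big_seq; apply: rpred_sum => p /rD pD.
rewrite linearZZ; apply: rpredZ; rewrite /HM_d mk_linearE /HM_d_fun; apply: rpredD.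
  apply: rpred_sum => i _; apply: rpredZ; apply: mem_lspan; exact: HM_face_HMD.
by apply: rpredZ; apply: mem_lspan; exact: HM_last_HMD.
Qed.

Definition HMD_subcomplex (D : conj_class G) : subcomplex (HM_complex B) :=
  @Subcomplex k (HM_complex B) (HMD_sub D) (@HMD_sub_d D).

Definition HHD (D : conj_class G) (n : nat) : lmodType k :=
  homology (sub_complex (HMD_subcomplex D)) n.

Definition HHD_incl (D : conj_class G) (n : nat) : {linear HHD D n -> HH B n} :=
  homology_map (sub_complex_incl (HMD_subcomplex D)) n.

End GradedHochschildMitchell.

(* Main.v *)
Require Import Defs.
From HB Require Import structures.
From mathcomp Require Import all_boot all_algebra finmap all_classical.

(* Makes [hom] denote morphism spaces again rather than the linear maps of
   [vector]. *)
Import Defs.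

(** The complex splits before homology is taken. A sequence of homogeneous
    morphisms (f_n, ..., f_0) has a total degree s_n ... s_0 in G, and C_n(B) is
    spanned by the tensors f_n ⊗ ... ⊗ f_0 of such sequences, because every morphism
    is a sum of homogeneous ones and the tensor product is multilinear. Grouping
    them by the conjugacy class of the total degree shows that the C^D_n span C_n:
    each degree lies in some class ([conj_class_ex]), and it is enough to test
    linear maps on homogeneous sequences ([HM_ext_homogeneous]).

    That the sum is direct cannot be read off generators, since C^D_n is given as
    the span of certain elements in a quotient. It is shown by operators: for each
    function phi : G -> k there is an endomorphism of C_n multiplying every
    homogeneous tensor of total degree t by phi(t) ([HM_degree_scale]). When phi is
    the indicator function of D, this endomorphism is the identity on C^D_n and
    kills C^D'_n for every other class D', as distinct classes are disjoint
    ([conj_set_inj]). Hence C_n is the direct sum of the C^D_n ([HMD_dsum_bij]).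

    Finally, homology commutes with direct sums of complexes. The projections of C
    onto its summands are chain maps, so they induce maps on homology that separate
    the summands; and a cycle is the sum of its finitely many nonzero components,
    which are cycles again ([homology_dsum_bij]). *)

Set Implicit Arguments.
Unset Strict Implicit.
Unset Printing Implicit Defensive.

Import GRing.Theory.
Local Open Scope classical_set_scope.
Local Open Scope ring_scope.

(** * Direct sums *)

Section DirectSums.
Variables (k : fieldType) (I : Type) (V : I -> lmodType k) (W : lmodType k).

Lemma dsum_coord_is_linear i : linear (fun x : dsum V => dsum_coord x i).
Proof. by move=> a x y; rewrite dsum_coordP. Qed.

Definition dsum_proj i : {linear dsum V -> V i} :=
  mk_linear (@dsum_coord_is_linear i).

Lemma bij_inv_linear (U : lmodType k) (f : {linear U -> W}) :
  bijective f -> exists g : {linear W -> U}, cancel f g /\ cancel g f.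
Proof.
move=> [g fK gK].
have g_lin : linear g by move=> a x y; apply: (can_inj fK); rewrite linearP !gK.
by exists (mk_linear g_lin).
Qed.

Variable f : forall i, {linear V i -> W}.

(** A criterion for internal direct sums that needs no formula for the inverse:
    the maps [q i] recover one component each, which gives independence. Their
    targets [U i] are arbitrary, so that [q i] may be a projection seen as an
    endomorphism of [W]. *)
Lemma dsum_lift_bij (U : I -> lmodType k) (q : forall i, {linear W -> U i}) :
  (forall i, injective (q i \o f i)) ->
  (forall i j, i <> j -> forall v, q i (f j v) = 0) ->
  (forall w, w \in lspan [set w | exists i v, w = f i v]) ->
  bijective (dsum_lift f).
Proof.
move=> q_inj q0 f_span.
have q_lift i x : q i (dsum_lift f x) = q i (f i (dsum_coord x i)).
  apply: (dsum_ext (f := q i \o dsum_lift f) (g := q i \o f i \o dsum_proj i)).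
  move=> j v.
  rewrite -[LHS]/(q i (dsum_lift f (dsum_in V j v))) dsum_lift_in.
  rewrite -[RHS]/(q i (f i (dsum_coord (dsum_in V j v) i))).
  have [ij|ij] := pselect (i = j); first by subst j; rewrite dsum_in_id.
  by rewrite q0 // dsum_in_neq ?linear0 // => /esym.
have lift_inj : injective (dsum_lift f).
  move=> x y xy; apply: dsum_eq => i; apply: (q_inj i).
  by rewrite [LHS]/= [RHS]/= -!q_lift xy.
have lift_surj w : exists x, dsum_lift f x = w.
  have /lspanP[s [sf ->]] := f_span w.
  elim: s sf => [|[a w'] s ih] sf; first by exists 0; rewrite big_nil linear0.
  have [|x xs] := ih; first by move=> p ps; apply: sf; rewrite inE ps orbT.
  have [i [v vE]] := sf (a, w') (mem_head _ _).
  exists (a *: dsum_in V i v + x).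
  by rewrite big_cons linearP dsum_lift_in xs vE.
have /choice[g gK] := lift_surj.
by exists g => // x; apply: lift_inj; rewrite gK.
Qed.

End DirectSums.

(** * Homology of a direct sum of complexes *)

Section HomologyDirectSum.
Variables (k : fieldType) (C : chain_complex k) (I : Type) (S : I -> subcomplex C).

(** The maps that separate the homology of the summands are induced by the
    projections [p i] of [C] onto [S i]. These are chain maps because the
    differential preserves each summand. *)
Lemma homology_dsum_bij :
  (forall n, bijective (dsum_lift (fun i => submod_incl (S i n)))) ->
  forall n, bijective
    (dsum_lift (fun i => homology_map (sub_complex_incl (S i)) n)).
Proof.
move=> S_bij.
have g_ex n := cid (bij_inv_linear (S_bij n)).
pose L n := dsum_lift (fun i => submod_incl (S i n)).
pose g n := projT1 (g_ex n).
have gK n : cancel (L n) (g n) by case: (projT2 (g_ex n)).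
have Kg n : cancel (g n) (L n) by case: (projT2 (g_ex n)).
have L_in n i v : L n (dsum_in _ i v) = submod_val v by rewrite [LHS]dsum_lift_in.
have g_in n i v : g n (submod_val v) = dsum_in (fun j => submod (S j n)) i v.
  by rewrite -L_in gK.
pose p i n : {linear C n -> submod (S i n)} := dsum_proj _ i \o g n.
have p_id i n v : p i n (submod_val v) = v.
  by rewrite -[LHS]/(dsum_coord (g n (submod_val v)) i) g_in dsum_in_id.
have p_neq i j n (v : submod (S j n)) : i <> j -> p i n (submod_val v) = 0.
  move=> ij; rewrite -[LHS]/(dsum_coord (g n (submod_val v)) i) g_in.
  by rewrite dsum_in_neq // => /esym.
have p_d i n v : cc_d (sub_complex (S i)) n (p i n.+1 v) = p i n (cc_d C n v).
  rewrite -[v]Kg; move: (g _ v) => {v}.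
  apply: (dsum_ext (f := cc_d (sub_complex (S i)) n \o p i n.+1 \o L n.+1)
                   (g := p i n \o cc_d C n \o L n.+1)) => j v.
  transitivity (cc_d (sub_complex (S i)) n (p i n.+1 (submod_val v))).
    by rewrite -L_in.
  transitivity (p i n (submod_val (cc_d (sub_complex (S j)) n v))); last first.
    by rewrite -[RHS]/(p i n (cc_d C n (L n.+1 (dsum_in _ j v)))) L_in.
  have [ij|ij] := pselect (i = j); first by subst j; rewrite !p_id.
  by rewrite !p_neq // linear0.
pose P i : chain_map C (sub_complex (S i)) :=
  @ChainMap k C (sub_complex (S i)) (p i) (p_d i).
move=> n; apply: (dsum_lift_bij (q := fun i => homology_map (P i) n)).
- move=> i; apply: (can_inj (g := id)) => h.
  have [z <-] := quot_proj_surj h.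
  rewrite [LHS](congr1 (homology_map (P i) n) (homology_map_class _ z)).
  rewrite homology_map_class; congr (homology_class _ _ _).
  by apply: val_inj; exact: p_id.
- move=> i j ij h; have [z <-] := quot_proj_surj h.
  rewrite (homology_map_class _ z) homology_map_class.
  rewrite -[RHS](linear0 (homology_class _ _)); congr (homology_class _ _ _).
  by apply: val_inj; exact: p_neq.
- move=> h; have [z <-] := quot_proj_surj h.
  (* Each component of [z] is a cycle, being the image of [z] under a chain map. *)
  have -> : z = \sum_(i <- fset_set
      ([set i | dsum_coord (g n (submod_val z)) i != 0] : set {classic I}))
      cycles_map (sub_complex_incl (S i)) n (cycles_map (P i) n z).
    apply: val_inj; rewrite -[LHS]Kg {1}(dsum_sum (g n _)) (linear_sum (L n)).
    rewrite [RHS](linear_sum (submod_incl (@is_cycle k C n))).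
    by apply: eq_bigr => i _; rewrite L_in.
  rewrite linear_sum; apply: rpred_sum => i _; apply: mem_lspan.
  exists i, (homology_map (P i) n (homology_class C n z)).
  by rewrite !homology_map_class.
Qed.

End HomologyDirectSum.

(** * Homogeneous tensors *)

Section Graded.
Variables (k : fieldType) (G : groupType) (B : kCategory k) (gr : grading G B).

Lemma graded_ext (W : lmodType k) (x y : B) (f g : {linear hom x y -> W}) :
  (forall s h, h \in piece gr x y s -> f h = g h) -> f =1 g.
Proof.
move=> fg h; have [e _ eK] := piece_dsum gr x y.
rewrite -[h]eK; move: (e h) => {h}.
pose L := dsum_lift (fun s => submod_incl (piece gr x y s)).
apply: (dsum_ext (f := f \o L) (g := g \o L)) => s v.
rewrite -[LHS]/(f (L (dsum_in _ s v))) -[RHS]/(g (L (dsum_in _ s v))).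
rewrite dsum_lift_in; exact: fg (submod_valP v).
Qed.

Lemma graded_lift (W : lmodType k) (x y : B) (f : G -> {linear hom x y -> W}) :
  exists F : {linear hom x y -> W},
    forall s h, h \in piece gr x y s -> F h = f s h.
Proof.
have [e [eK _]] := bij_inv_linear (piece_dsum gr x y).
pose L := dsum_lift (fun s => submod_incl (piece gr x y s)).
pose F := dsum_lift (fun s => f s \o submod_incl (piece gr x y s)).
exists (F \o e) => s h hs; pose v : submod (piece gr x y s) := Submod hs.
have -> : h = L (dsum_in _ s v) by rewrite dsum_lift_in.
by rewrite -[LHS]/(F (e (L _))) eK !dsum_lift_in.
Qed.

(** Induction on the number of factors: freezing the other argument of [tpure]
    reduces to [graded_ext] in the last factor, and then to the induction hypothesis
    in the first one. *)
Lemma tens_ext_homogeneous (W : lmodType k) n x (s : objs B n) y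
    (f g : {linear tens x s y -> W}) :
  (forall c t, has_degree gr c t -> f (elem_tens c) = g (elem_tens c)) -> f =1 g.
Proof.
elim: n x s W f g => [|n ih] x s W f g fg.
  by apply: graded_ext => t h ht; exact: fg ht.
apply: tensor_ext => t v.
have f_linr : linear (fun v => f (tpure t v)).
  by move=> a v1 v2; rewrite tpure_linearr linearP.
have g_linr : linear (fun v => g (tpure t v)).
  by move=> a v1 v2; rewrite tpure_linearr linearP.
apply: (graded_ext (f := mk_linear f_linr) (g := mk_linear g_linr)) => u h hu.
rewrite [LHS]mk_linearE [RHS]mk_linearE; move: t {f_linr g_linr}.
have f_linl : linear (fun t => f (tpure t h)).
  by move=> a t1 t2; rewrite tpure_linearl linearP.
have g_linl : linear (fun t => g (tpure t h)).
  by move=> a t1 t2; rewrite tpure_linearl linearP.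
apply: (ih _ _ _ (mk_linear f_linl) (mk_linear g_linl)) => c t ct.
by apply: (fg (c, h) (t * u)%g); exists t, u.
Qed.

Lemma HM_ext_homogeneous (W : lmodType k) n (f g : {linear HM_mod B n -> W}) :
  (forall (c : cyc B n) t, has_degree gr (projT2 c) t -> f (elem c) = g (elem c)) ->
  f =1 g.
Proof.
move=> fg; apply: dsum_ext => p.
apply: (@tens_ext_homogeneous W n p.1 p.2 p.1
  (f \o HM_in (B := B) (n := n) p) (g \o HM_in (B := B) (n := n) p)) => c t ct.
exact: (fg (existT _ p c) t).
Qed.

(** On [hom x y] the operator is the diagonal one attached to the grading. For
    longer tensors, t ⊗ h with h homogeneous of degree u is sent to M_u(t) ⊗ h, where
    M_u is the operator for the translate phi(- u): if t has degree s, then t ⊗ h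
    has degree s u. The indicator function of a conjugacy class has translates not
    of this form, so the induction requires a more general phi. *)
Lemma tens_degree_scale n x (s : objs B n) y (phi : G -> k) :
  exists M : {linear tens x s y -> tens x s y},
    forall c t, has_degree gr c t -> M (elem_tens c) = phi t *: elem_tens c.
Proof.
elim: n x s phi => [|n ih] x s phi.
  have L t : linear (fun h : hom x y => phi t *: h).
    by move=> a u v; rewrite scalerDr !scalerA mulrC.
  have [F FE] := graded_lift (fun t => mk_linear (L t)).
  by exists F => c t ct; exact: FE ct.
(* [M u] is the operator on the n + 1 leftmost factors for phi(- u). *)
have [M ME] := choice (fun u => ih s.1 s.2 (fun t => phi (t * u)%g)).
have R t u : linear (fun h : hom x s.1 => tpure (M u t) h).
  by move=> a h1 h2; rewrite tpure_linearr.
have [F FE] := choice (fun t => graded_lift (fun u => mk_linear (R t u))).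
(* [F t] is assembled piece by piece, so linearity in [t] is tested on pieces. *)
have Fl h : linear (fun t => F t h).
  move=> a t1 t2.
  apply: (graded_ext (g := mk_linear (lin_comb_is_linear a (F t1) (F t2)))) => u h' hu.
  by rewrite [RHS]/= !(FE _ _ _ hu) [LHS]/= linearP tpure_linearl.
pose mu := mk_bilinear Fl (fun t => linearP (F t)).
exists (tensor_lift mu).
move=> [c h] _ [t [u [/= ct hu ->]]].
transitivity (mu (elem_tens c) h); first exact: (tensor_liftE mu).
rewrite -[LHS]/(F (elem_tens c) h) (FE _ _ _ hu) [LHS]mk_linearE.
rewrite (ME _ _ _ ct).
exact: (linearZZ (mk_linear (tpure_linearl h))).
Qed.

Lemma HM_degree_scale n (phi : G -> k) :
  exists M : {linear HM_mod B n -> HM_mod B n},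
    forall (c : cyc B n) t, has_degree gr (projT2 c) t -> M (elem c) = phi t *: elem c.
Proof.
have M_ex (p : objs B n.+1) := cid (tens_degree_scale p.1 p.2 p.1 phi).
exists (dsum_lift (fun p => HM_in (B := B) (n := n) p \o projT1 (M_ex p))).
move=> [p c] t ct; rewrite /elem dsum_lift_in [LHS]/=.
rewrite (projT2 (M_ex p) _ _ ct); exact: (linearZZ (HM_in (B := B) (n := n) p)).
Qed.

(** * The decomposition by conjugacy classes *)

Lemma conj_set_inj (D D' : conj_class G) g :
  conj_set D g -> conj_set D' g -> D = D'.
Proof.
have classE (E : conj_class G) : conj_set E g ->
    conj_set E = [set conjg g h | h in [set: G]].
  case: E => E [e eE] /=; rewrite {}eE => -[h _ <-].
  apply/seteqP; split => [_ [u _ <-]|_ [u _ <-]].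
    by exists (h^-1 * u)%g => //; rewrite -conjgM mulVKg.
  by exists (h * u)%g => //; rewrite conjgM.
move=> /classE DE /classE; rewrite -{}DE.
case: D D' => D Dp [D' D'p] /= e; subst D'; congr ConjClass; exact: Prop_irrelevance.
Qed.

Lemma conj_class_ex (g : G) : exists D : conj_class G, conj_set D g.
Proof.
have Dp : exists e, [set conjg g h | h in [set: G]] = [set conjg e h | h in [set: G]].
  by exists g.
by exists (ConjClass Dp); exists 1%g => //; rewrite conjg1.
Qed.

(** The separating map for [D] is the operator scaling by the indicator function of
    [D], which projects onto the part of class [D]. *)
Lemma HMD_dsum_bij n :
  bijective (dsum_lift (fun D : conj_class G => submod_incl (HMD_sub gr D n))).
Proof.
pose ind (D : conj_class G) (t : G) : k := if `[< conj_set D t >] then 1 else 0.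
have [q qE] := choice (fun D => HM_degree_scale n (ind D)).
have q_id D v : v \in HMD_sub gr D n -> q D v = v.
  move=> /lspanP[s [sD ->]]; rewrite linear_sum !big_seq; apply: eq_bigr => a /sD.
  move=> [c [t [ct Dt ->]]]; rewrite (linearZZ (q D)) (qE _ _ _ ct) /ind.
  by rewrite asboolT // scale1r.
have q_neq D D' v : D <> D' -> v \in HMD_sub gr D' n -> q D v = 0.
  move=> DD' /lspanP[s [sD ->]]; rewrite linear_sum big_seq big1 // => a /sD.
  move=> [c [t [ct D't ->]]]; rewrite (linearZZ (q D)) (qE _ _ _ ct) /ind.
  rewrite asboolF ?scale0r ?scaler0 // => Dt; exact: DD' (conj_set_inj Dt D't).
apply: (dsum_lift_bij (q := q)).
- move=> D u v uv; apply: val_inj.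
  by rewrite -(q_id D _ (valP u)) -(q_id D _ (valP v)).
- by move=> D D' DD' v; exact: q_neq DD' (valP v).
(* It remains to span: the quotient by the sum of all the parts vanishes on
   homogeneous tensors. *)
- move=> v; apply/quot_proj_eq0; set pi := quot_proj _.
  have zlin : linear (fun u : HM_mod B n => 0 *: pi u).
    by move=> a u w; rewrite !scale0r scaler0 addr0.
  rewrite -[RHS](scale0r (pi v)).
  apply: (HM_ext_homogeneous (g := mk_linear zlin)) => c t ct.
  rewrite [RHS]mk_linearE scale0r; apply/quot_proj_eq0/mem_lspan.
  have [D Dt] := conj_class_ex t.
  have cD : elem c \in HMD_sub gr D n by apply: mem_lspan; exists c, t.
  by exists D, (Submod cD).
Qed.

End Graded.

Theorem theorem3p6 (k : fieldType) (G : groupType) (B : kCategory k)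
    (gr : grading G B) (n : nat) :
  bijective (dsum_lift (fun D : conj_class G => HHD_incl gr D n)
             : dsum (fun D : conj_class G => HHD gr D n) -> HH B n).
Proof.
exact: (homology_dsum_bij (S := HMD_subcomplex gr) (HMD_dsum_bij gr)).
Qed.
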